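(* Let $\xi=(\xi_1,\dots,\xi_n)$ be an $n$-dimensional standard normal vector, and for a vector $u=(u_1,\dots,u_n)\in\mathbb{R}^n$ let $u\odot\xi=(u_1\xi_1,\dots,u_n\xi_n)$. Consider the function $u\mapsto \mathbb{E}\,\|u\odot\xi\|_\infty=\mathbb{E}\max_{1\le i\le n}|u_i\xi_i|$ on the set of Euclidean unit vectors $u\in\mathbb{R}^n$. (1) If $n=2$, then $\mathbb{E}\,\|u\odot\xi\|_\infty$ is independent of the choice of the unit vector $u$. (2) If $n\ge 3$, then $\mathbb{E}\,\|u\odot\xi\|_\infty$ attains its maximum over all unit vectors $u$ whenever at most two coordinates of $u$ are non-zero, and it attains its minimum over all unit vectors $u$ when $u=(\pm 1/\sqrt{n},\dots,\pm 1/\sqrt{n})$ (for any choice of signs).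
   Context: A standard normal vector is a random vector whose coordinates are independent, identically distributed standard normal random variables. For $x\in\mathbb{R}^n$, $\|x\|_\infty=\max_{1\le i\le n}|x_i|$. A unit vector is a vector $u\in\mathbb{R}^n$ with $\sum_{i=1}^n u_i^2=1$. *)

(* Defs.v *)
From HB Require Import structures.
From mathcomp Require Import all_boot all_order all_algebra.
From mathcomp Require Import all_classical all_reals all_analysis.
Set Implicit Arguments.
Unset Strict Implicit.
Unset Printing Implicit Defensive.
Import Order.TTheory GRing.Theory Num.Theory.
Import numFieldNormedType.Exports.
Local Open Scope classical_set_scope.
Local Open Scope ring_scope.

Section RandomVectors.
Context {d : measure_display} {T : measurableType d} {R : realType}.
Context {P : probability T R}.

Definition mutually_independent (I : finType) (X : I -> {RV P >-> R}) : Prop :=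
  forall (J : {set I}) (B : I -> set R),
    (forall i, i \in J -> measurable (B i)) ->
    P (\bigcap_(i in [set` J]) (X i @^-1` B i)) =
    (\prod_(i in J) P (X i @^-1` B i))%E.

(* The two measures are compared on Borel sets only: outside them the values
   of a measure are unconstrained. *)
Definition standard_normal (X : {RV P >-> R}) : Prop :=
  forall A : set R, measurable A -> distribution P X A = normal_prob 0 1 A.

Definition standard_normal_vector n (xi : 'I_n -> {RV P >-> R}) : Prop :=
  mutually_independent xi /\ forall i, standard_normal (xi i).

Definition realization n (xi : 'I_n -> {RV P >-> R}) (t : T) : 'rV[R]_n :=
  \row_(i < n) xi i t.

End RandomVectors.

Section Vectors.
Context {R : realType} {n : nat}.

Definition odot (u x : 'rV[R]_n) : 'rV[R]_n := \row_(i < n) (u 0 i * x 0 i).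

Definition unit_vectors : set 'rV[R]_n :=
  [set u : 'rV[R]_n | \sum_(i < n) u 0 i ^+ 2 = 1].

End Vectors.

(* The norm of 'rV[R]_n is the sup norm, so that the norm in
   [expected_sup_norm] below is the maximum of the |u_i xi_i|. *)
Lemma sup_norm_odot d (T : measurableType d) (R : realType)
    (P : probability T R) n (xi : 'I_n -> {RV P >-> R}) (u : 'rV[R]_n) (t : T) :
  `|odot u (realization xi t)| = \big[Num.max/0]_(i < n) `|u 0 i * xi i t|.
Proof.
rewrite /Num.norm /= mx_normrE.
apply/le_anti/andP; split.
  apply/bigmax_leP; split; first exact: bigmax_ge_id.
  move=> [i j] _ /=; rewrite !mxE.
  exact: (le_bigmax _ (fun j => `|u 0 j * xi j t|)).
apply/bigmax_leP; split; first exact: bigmax_ge_id.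
move=> j _; apply: le_trans (le_bigmax _ _ (ord0, j)).
by rewrite /= !mxE.
Qed.

Definition expected_sup_norm d (T : measurableType d) (R : realType)
    (P : probability T R) n (xi : 'I_n -> {RV P >-> R}) (u : 'rV[R]_n) : \bar R :=
  ('E_P[fun t => `|odot u (realization xi t)|%R])%E.

Definition attains_max_at (R : realType) (V : Type) (f : V -> \bar R)
    (S : set V) (u : V) : Prop :=
  S u /\ forall v, S v -> (f v <= f u)%E.

Definition attains_min_at (R : realType) (V : Type) (f : V -> \bar R)
    (S : set V) (u : V) : Prop :=
  S u /\ forall v, S v -> (f u <= f v)%E.

(* Main.v *)
Require Import Defs.
From HB Require Import structures.
From mathcomp Require Import all_boot all_order all_algebra.
From mathcomp Require Import all_classical all_reals all_analysis.
From mathcomp Require Import measurable_realfun ring lra.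
Import Order.TTheory GRing.Theory Num.Theory.
Import numFieldNormedType.Exports.
Local Open Scope classical_set_scope.
Local Open Scope ring_scope.

(** Write [F] for the distribution function of [|xi_i|].  By independence the
    expected maximum is [\int_0^oo (1 - \prod_i F(s / |u_i|)) ds].  For two
    coordinates [(a, b) = (r cos theta, r sin theta)] the tail integrals
    [\int_t^oo (1 - F(s / a) F(s / b)) ds] are explicit in terms of [F] and
    [F'].  They equal [r F'(0)] at [t = 0], and for [t > 0] they decrease in
    [theta] on [(0, pi/4]], because [F(x) / (x F'(x))] is increasing.
    Averaging over [t], distributed as the maximum of the other coordinates,
    shows that making the squares of two coordinates more unequal, with their
    sum fixed, does not decrease the expected maximum.  Merging two non-zero
    coordinates into one repeatedly gives the maximum; moving a square below
    [1/n] and a square above [1/n] towards each other, until one of them is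
    [1/n], gives the minimum. *)

(** * The half-normal distribution *)

Section HalfNormal.
Context {R : realType}.
Implicit Types x y a b s t : R.
Local Notation mu := (@lebesgue_measure R).

Definition normal_cdf x : R :=
  (\int[mu]_(t in [set` Interval -oo%O (BRight x)]) normal_pdf 0 1 t)%R.

Definition half_normal_cdf x : R := normal_cdf x - normal_cdf (- x).

Definition half_normal_pdf x : R := 2 * normal_pdf 0 1 x.

Local Notation e := half_normal_cdf.
Local Notation p := half_normal_pdf.

Lemma half_normal_pdfE x : p x = p 0 * expR (- (x ^+ 2 / 2)).
Proof.
rewrite /half_normal_pdf normal_pdfE ?oner_neq0// /normal_fun !subr0 expr1n.
by rewrite expr0n /= oppr0 mul0r expR0 mulr1 mulNr mulrA.
Qed.

Lemma half_normal_pdf_gt0 x : 0 < p x.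
Proof.
rewrite /half_normal_pdf normal_pdfE ?oner_neq0// mulr_gt0// mulr_gt0//.
  by rewrite normal_peak_gt0// oner_neq0.
exact: expR_gt0.
Qed.

Lemma half_normal_pdf_abs_le x y : `|x| <= `|y| -> p y <= p x.
Proof.
move=> xy; rewrite half_normal_pdfE (half_normal_pdfE x).
rewrite ler_pM2l ?half_normal_pdf_gt0// ler_expR lerN2 ler_pM2r//.
by rewrite -[leLHS]real_normK ?num_real// -[leRHS]real_normK ?num_real// lerXn2r ?nnegrE.
Qed.

(** Rotation invariance of the Gaussian. This lets a product of two densities be integrated in
    closed form. *)
Lemma half_normal_pdfM x y z : z ^+ 2 = x ^+ 2 + y ^+ 2 ->
  p x * p y = p 0 * p z.
Proof.
move=> zxy; rewrite half_normal_pdfE (half_normal_pdfE y) (half_normal_pdfE z).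
by rewrite zxy mulrDl opprD expRD; ring.
Qed.

#[global] Instance is_derive_half_normal_pdf x : is_derive x 1 p (- (x * p x)).
Proof.
have pE : p = p 0 \*o (expR \o (fun x => - (x ^+ 2 / 2))).
  by apply/funext => z; rewrite half_normal_pdfE.
rewrite [X in is_derive _ _ X]pE; apply: is_derive_eq.
by rewrite (half_normal_pdfE x) /GRing.scale/=; field.
Qed.

Lemma is_derive_normal_cdf x : is_derive x 1 normal_cdf (normal_pdf 0 1 x).
Proof.
have [||||df dE] := @continuous_FTC1 R (normal_pdf 0 1) -oo%O x (x + 1).
- by rewrite ltrDl.
- exact: integrableS (integrable_normal_pdf 0 1).
- by rewrite ltNyr.
- by apply: continuous_normal_pdf; exact: oner_neq0.
by apply: DeriveDef => //; rewrite -derive1E.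
Qed.

#[global] Instance is_derive_half_normal_cdf x : is_derive x 1 e (p x).
Proof.
rewrite /half_normal_cdf.
have ? := is_derive_normal_cdf x.
have ? := is_derive_normal_cdf (- x).
apply: is_derive_eq.
rewrite /half_normal_pdf !normal_pdfE ?oner_neq0// /normal_fun !subr0 sqrrN.
by ring.
Qed.

Lemma half_normal_cdf0 : e 0 = 0.
Proof. by rewrite /half_normal_cdf oppr0 subrr. Qed.

Lemma half_normal_cdf_le x y : x <= y -> e x <= e y.
Proof.
move=> xy; apply: (@ger0_derive1_ndecr _ e x y) => //.
- by move=> z _; rewrite derive1E derive_val ltW// half_normal_pdf_gt0.
- by apply: derivable_within_continuous => z _; apply: ex_derive.
Qed.

Lemma half_normal_cdf_ge0 x : 0 <= x -> 0 <= e x.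
Proof. by move=> x0; rewrite -half_normal_cdf0 half_normal_cdf_le. Qed.

Lemma normal_prob_itvNyc x :
  normal_prob 0 1 [set` Interval -oo%O (BRight x)] = (normal_cdf x)%:E.
Proof.
rewrite /normal_cdf /Rintegral fineK//.
apply: integrable_fin_num => //.
by apply: integrableS (integrable_normal_pdf 0 1).
Qed.

Lemma half_normal_cdf_prob x : 0 <= x -> normal_prob 0 1 `[- x, x] = (e x)%:E.
Proof.
move=> x0.
(* A single point has no mass, and without its left endpoint the interval is a difference of two
   rays. *)
have nP1 : normal_prob 0 1 `[- x, x] = normal_prob 0 1 `]- x, x].
  rewrite /normal_prob integral_itv_obnd_cbnd//.
  apply/measurable_EFinP; apply: measurable_funTS; exact: measurable_normal_pdf.
rewrite nP1 /half_normal_cdf EFinB -!normal_prob_itvNyc.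
rewrite (_ : `]- x, x]%classic = `]-oo, x] `\` `]-oo, - x]).
  rewrite measureD//= ?setIidr//.
    by apply: subset_itvl; rewrite bnd_simp; lra.
  by rewrite normal_prob_itvNyc ltry.
apply/seteqP; split=> z /=; rewrite !in_itv/=.
  by move=> /andP[xz ->]; split=> //; apply/negP; rewrite -ltNge.
by move=> [-> /negP]; rewrite -ltNge => ->.
Qed.

Lemma half_normal_cdf_le1 x : e x <= 1.
Proof.
have [x0|x0] := leP 0 x.
  by rewrite -lee_fin -half_normal_cdf_prob// probability_le1.
by rewrite (le_trans _ (@ler01 R))// -half_normal_cdf0 half_normal_cdf_le// ltW.
Qed.

Lemma cvg_half_normal_cdf : e x @[x --> +oo] --> (1 : R).
Proof.
(* Under the normal law the identity is a random variable with that law, so the limits of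
   distribution functions at both infinities apply to [normal_cdf]. *)
have idP : (fun x : measurableTypeR R => x : R) \in mfun.
  by rewrite inE; exact: measurable_id.
pose X : {RV normal_prob (0 : R) 1 >-> R} := mfun_Sub idP.
have cE : fine \o cdf X = normal_cdf.
  apply/funext => y /=.
  by rewrite /cdf /distribution /pushforward /= preimage_id normal_prob_itvNyc.
have c1 : normal_cdf x @[x --> +oo] --> (1 : R).
  by rewrite -cE; exact: fine_cvg (cvg_cdfy1 X).
have c0 : normal_cdf (- x) @[x --> +oo] --> (0 : R).
  by rewrite -(@cvgNy_compNP _ _ normal_cdf) -cE; exact: fine_cvg (cvg_cdfNy0 X).
by rewrite -[X in _ --> X]subr0; exact: cvgB.
Qed.

End HalfNormal.

Lemma is_derive_ge0_le {R : realType} (f df : R -> R) (a b : R) : a <= b ->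
  (forall x, a <= x <= b -> is_derive x 1 f (df x)) ->
  (forall x, a <= x <= b -> 0 <= df x) -> f a <= f b.
Proof.
move=> ab fdf df0.
have ooW x : x \in `]a, b[ -> a <= x <= b.
  by rewrite in_itv/= => /andP[/ltW -> /ltW ->].
apply: (@ger0_derive1_ndecr _ f a b) => //.
- by move=> x /ooW xab; have [] := fdf _ xab.
- by move=> x /ooW xab; have ? := fdf _ xab; rewrite derive1E derive_val df0.
- apply: derivable_within_continuous => x; rewrite in_itv/= => xab.
  by have [] := fdf _ xab.
Qed.

(** * Tail bounds, and the ratio of distribution function to density *)

Section HalfNormalTail.
Context {R : realType}.
Implicit Types x y a b r s t : R.
Local Notation e := (@half_normal_cdf R).
Local Notation p := (@half_normal_pdf R).

Lemma cvg_half_normal_pdf : p x @[x --> +oo] --> (0 : R).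
Proof.
apply: (@squeeze_cvgr _ _ _ _ (cst 0) (fun x => p 0 * expR 2^-1 * expR (- x))).
(* From [0 <= (x - 1) ^+ 2] follows [- (x ^+ 2 / 2) <= 1 / 2 - x]. *)
- near=> x; rewrite ltW ?half_normal_pdf_gt0//= half_normal_pdfE.
  rewrite -mulrA -expRD ler_pM2l ?half_normal_pdf_gt0// ler_expR.
  by have := sqr_ge0 (x - 1); lra.
- exact: cvg_cst.
- rewrite -[X in _ --> X](mulr0 (p 0 * expR 2^-1)).
  by apply: cvgM; [exact: cvg_cst|exact: cvgr_expR].
Unshelve. all: by end_near. Qed.

(** Mills' bound. The function [p z / z + e z] has derivative [- p z / z ^+ 2], so it decreases for
    positive [z]; it dominates [e], which tends to 1, so it is at least 1. *)
Lemma half_normal_ccdf_le x : 0 <= x -> x * (1 - e x) <= p x.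
Proof.
rewrite le_eqVlt => /predU1P[<-|x0].
  by rewrite mul0r ltW// half_normal_pdf_gt0.
suff h : 1 - e x <= p x / x by rewrite mulrC -ler_pdivlMr.
pose g := (fun z => p z * z^-1) \+ e.
suff : 1 <= g x by rewrite /g/=; lra.
have gx y : x <= y -> e y <= g x.
  move=> xy.
  have -> : g x = - (- g x) by rewrite opprK.
  rewrite lerNr; apply: (@le_trans _ _ (- g y)).
    apply: (@is_derive_ge0_le _ (\- g) (fun z => p z / z ^+ 2) x y xy) => z.
      move=> /andP[xz _]; have z0 : z != 0 by rewrite gt_eqF// (lt_le_trans x0).
      have ? := @is_deriveV _ id z _ 1 z0 (is_derive_id _ _).
      rewrite /g; apply: is_derive_eq.
      by rewrite /GRing.scale/=; field.
    by move=> _; rewrite divr_ge0 ?sqr_ge0// ltW// half_normal_pdf_gt0.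
  rewrite /g lerN2/= lerDr divr_ge0 ?(le_trans (ltW x0) xy)//.
  by rewrite ltW// half_normal_pdf_gt0.
apply: (cvgr_to_le cvg_half_normal_cdf).
near=> y; apply: gx; near: y; apply: nbhs_pinfty_ge; exact: num_real.
Unshelve. all: by end_near. Qed.

Lemma cvg_half_normal_ccdf : x * (1 - e x) @[x --> +oo] --> (0 : R).
Proof.
apply: (@squeeze_cvgr _ _ _ _ (cst 0) p).
- near=> x.
  have x0 : 0 <= x by near: x; apply: nbhs_pinfty_ge; exact: num_real.
  by rewrite half_normal_ccdf_le// mulr_ge0 ?subr_ge0 ?half_normal_cdf_le1.
- exact: cvg_cst.
- exact: cvg_half_normal_pdf.
Unshelve. all: by end_near. Qed.

(** The expression vanishes at 0 and has derivative [2 * x * e x]. It carries the sign of the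
    derivative of [e x / (x * p x)]. *)
Lemma half_normal_cdf_pdf_ge x : 0 <= x -> 0 <= x * p x - e x * (1 - x ^+ 2).
Proof.
move=> x0; pose f := (id \* p) \- e \* (cst 1 \- (id \* id)).
suff : f 0 <= f x by rewrite /f/= half_normal_cdf0 !mul0r subr0 expr2.
apply: (@is_derive_ge0_le _ f (fun z => 2 * z * e z) 0 x x0) => z.
  by move=> _; rewrite /f; apply: is_derive_eq; rewrite /GRing.scale/=; ring.
move=> /andP[z0 _]; rewrite mulr_ge0 ?half_normal_cdf_ge0//; lra.
Qed.

(** Monotonicity of [e x / (x * p x)], cross-multiplied; its derivative is nonnegative by
    [half_normal_cdf_pdf_ge]. *)
Lemma half_normal_cdf_pdf_ratio x y : 0 < x -> x <= y ->
  e x * (y * p y) <= e y * (x * p x).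
Proof.
move=> x0 xy; pose k := e \* (fun z => (z * p z)^-1).
have y0 : 0 < y by exact: lt_le_trans xy.
have xp0 z : 0 < z -> 0 < z * p z.
  by move=> z0; rewrite mulr_gt0// half_normal_pdf_gt0.
suff : k x <= k y.
  by rewrite /k/= ler_pdivrMr ?xp0// mulrAC ler_pdivlMr ?xp0.
apply: (@is_derive_ge0_le _ k
  (fun z => p z * (z * p z - e z * (1 - z ^+ 2)) / (z * p z) ^+ 2) x y xy) => z.
  move=> /andP[xz _]; have z0 : 0 < z by exact: lt_le_trans xz.
  have zp0 : z * p z != 0 by rewrite gt_eqF ?xp0.
  have dzp : is_derive z 1 (fun z => z * p z) (p z - z ^+ 2 * p z).
    have -> : (fun z => z * p z) = id \* p by [].
    by apply: is_derive_eq; rewrite /GRing.scale/=; ring.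
  have ? := @is_deriveV _ (fun z => z * p z) z _ 1 zp0 dzp.
  rewrite /k; apply: is_derive_eq; rewrite /GRing.scale/=.
  by field; rewrite !gt_eqF ?half_normal_pdf_gt0.
move=> /andP[xz _]; have z0 : 0 < z by exact: lt_le_trans xz.
rewrite divr_ge0 ?sqr_ge0// mulr_ge0 ?half_normal_cdf_pdf_ge//.
  by rewrite ltW// half_normal_pdf_gt0.
exact: ltW.
Qed.

End HalfNormalTail.

(** * Tail integrals for two coordinates *)

Section PairTail.
Context {R : realType}.
Implicit Types x y a b r s t : R.
Local Notation mu := (@lebesgue_measure R).
Local Notation e := (@half_normal_cdf R).
Local Notation p := (@half_normal_pdf R).

(* When [r ^+ 2 = a ^+ 2 + b ^+ 2], integrating [1 - e (t / a) * e (t / b)] by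
   parts leaves the integral of a multiple of [p (t / a) * p (t / b)], and
   this product is again a multiple of [p] at [t * r / (a * b)]. *)
Definition pair_primitive a b r t :=
  t * (1 - e (t / a) * e (t / b)) - a * p (t / a) * e (t / b)
  - b * p (t / b) * e (t / a) + p 0 * r * e (t * r / (a * b)).

(** All arguments are functions, so that one computation covers the derivatives in [t] and in the
    angle. The relations [A X = T] and [B Y = T] cancel the terms with the derivative of [p] against
    those from [T]; the relation between squares turns [p 0 * p (Z z)] into [p (X z) * p (Y z)]. *)
Lemma is_derive_pair_primitive (T A B X Y Z : R -> R)
    (r z dT dA dB dX dY dZ : R) :
  is_derive z 1 T dT -> is_derive z 1 A dA -> is_derive z 1 B dB ->
  is_derive z 1 X dX -> is_derive z 1 Y dY -> is_derive z 1 Z dZ ->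
  A z * X z = T z -> B z * Y z = T z -> Z z ^+ 2 = X z ^+ 2 + Y z ^+ 2 ->
  is_derive z 1 (fun z => T z * (1 - e (X z) * e (Y z)) - A z * p (X z) * e (Y z)
    - B z * p (Y z) * e (X z) + p 0 * r * e (Z z))
   (dT * (1 - e (X z) * e (Y z)) - dA * (p (X z) * e (Y z))
    - dB * (p (Y z) * e (X z)) +
    p (X z) * p (Y z) * (r * dZ - A z * dY - B z * dX)).
Proof.
move=> hT hA hB hX hY hZ AX BY Z2.
have -> : (fun z => T z * (1 - e (X z) * e (Y z)) - A z * p (X z) * e (Y z)
    - B z * p (Y z) * e (X z) + p 0 * r * e (Z z)) =
  (T \* (cst 1 \- (e \o X) \* (e \o Y)) \- A \* (p \o X) \* (e \o Y)
    \- B \* (p \o Y) \* (e \o X)) \+ (p 0 * r) \*o (e \o Z) by [].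
apply: is_derive_eq; rewrite /GRing.scale/=.
have pp := half_normal_pdfM _ _ _ Z2.
transitivity (dT * (1 - e (X z) * e (Y z)) - dA * (p (X z) * e (Y z))
    - dB * (p (Y z) * e (X z)) +
    (p (X z) * p (Y z) * (- A z * dY - B z * dX) + p 0 * p (Z z) * (r * dZ)) +
    (A z * X z - T z) * (p (X z) * dX * e (Y z)) +
    (B z * Y z - T z) * (p (Y z) * dY * e (X z))); first by ring.
by rewrite AX BY subrr -pp; ring.
Qed.

Lemma is_derive_pair_primitive_t a b r t : 0 < a -> 0 < b ->
  r ^+ 2 = a ^+ 2 + b ^+ 2 ->
  is_derive t 1 (pair_primitive a b r) (1 - e (t / a) * e (t / b)).
Proof.
move=> a0 b0 r2.
have dl c : is_derive t 1 (fun s => s * c) c.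
  have -> : (fun s => s * c) = id \* cst c by [].
  by apply: is_derive_eq; rewrite /GRing.scale/=; ring.
have an0 : a != 0 by rewrite gt_eqF.
have bn0 : b != 0 by rewrite gt_eqF.
have hZ : is_derive t 1 (fun s => s * r / (a * b)) (r / (a * b)).
  have -> : (fun s => s * r / (a * b)) = (fun s => s * (r / (a * b))).
    by apply/funext => s; rewrite mulrA.
  exact: dl.
have h := is_derive_pair_primitive id (cst a) (cst b) _ _ _ r t 1 0 0 _ _ _
  (is_derive_id _ _) (is_derive_cst _ _ _) (is_derive_cst _ _ _)
  (dl a^-1) (dl b^-1) hZ.
refine (is_derive_eq (h _ _ _) _); try by rewrite /=; field.
- rewrite [LHS](_ : _ = r ^+ 2 * (t / (a * b)) ^+ 2); last by ring.
  by rewrite r2; field; rewrite an0 bn0.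
- rewrite /= !mul0r !subr0.
  (* The coefficient of the product of densities is a multiple of [r ^+ 2 - a ^+ 2 - b ^+ 2], hence
     zero. *)
  rewrite [X in _ + _ * X](_ : _ = (r ^+ 2 - a ^+ 2 - b ^+ 2) / (a * b)).
    by rewrite r2; ring.
  by field; rewrite an0 bn0.
Qed.

(** Here [T] is constant, and the product of densities drops out because the squares of [cos] and
    [sin] sum to 1. What remains comes from differentiating the factors [r * cos z] and
    [r * sin z]. *)
Lemma is_derive_pair_primitive_theta r t (theta : R) : 0 < r ->
  0 < cos theta -> 0 < sin theta ->
  is_derive theta 1 (fun z => pair_primitive (r * cos z) (r * sin z) r t)
   (r * (sin theta * p (t / (r * cos theta)) * e (t / (r * sin theta))
       - cos theta * e (t / (r * cos theta)) * p (t / (r * sin theta)))).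
Proof.
move=> r0 c0 s0.
have rn0 : r != 0 by rewrite gt_eqF.
have cn0 : cos theta != 0 by rewrite gt_eqF.
have sn0 : sin theta != 0 by rewrite gt_eqF.
have hA : is_derive theta 1 (fun z => r * cos z) (- (r * sin theta)).
  have -> : (fun z => r * cos z) = r \*o cos by [].
  by apply: is_derive_eq; rewrite /GRing.scale/=; ring.
have hB : is_derive theta 1 (fun z => r * sin z) (r * cos theta).
  have -> : (fun z => r * sin z) = r \*o sin by [].
  by apply: is_derive_eq; rewrite /GRing.scale/=; ring.
have inv (f : R -> R) (df c : R) : f theta != 0 -> is_derive theta 1 f df ->
    is_derive theta 1 (fun z => c * (f z)^-1) (- (c * df / f theta ^+ 2)).
  move=> f0 hf; have ? := @is_deriveV _ f theta _ 1 f0 hf.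
  have -> : (fun z => c * (f z)^-1) = c \*o (fun z => (f z)^-1) by [].
  by apply: is_derive_eq; rewrite /GRing.scale/=; field.
have hAB : is_derive theta 1 (fun z => r * cos z * (r * sin z))
    (r ^+ 2 * (cos theta ^+ 2 - sin theta ^+ 2)).
  have -> : (fun z => r * cos z * (r * sin z)) =
    (fun z => r * cos z) \* (fun z => r * sin z) by [].
  by apply: is_derive_eq; rewrite /GRing.scale/=; ring.
have rc0 : r * cos theta != 0 by rewrite mulf_neq0.
have rs0 : r * sin theta != 0 by rewrite mulf_neq0.
have h := is_derive_pair_primitive (cst t) _ _ _ _ _ r theta 0 _ _ _ _ _
  (is_derive_cst _ _ _) hA hB (inv _ _ t rc0 hA) (inv _ _ t rs0 hB)
  (inv _ _ (t * r) (mulf_neq0 rc0 rs0) hAB).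
refine (is_derive_eq (h _ _ _) _).
- by rewrite /=; field; rewrite cn0 rn0.
- by rewrite /=; field; rewrite sn0 rn0.
- rewrite -[LHS]mulr1 -(cos2Dsin2 theta).
  by field; rewrite cn0 sn0 rn0.
- rewrite [X in _ + _ * X](_ : _ = t * (cos theta ^+ 2 - sin theta ^+ 2) *
      (cos theta ^+ 2 + sin theta ^+ 2 - 1) / (cos theta * sin theta) ^+ 2).
    by rewrite cos2Dsin2; ring.
  by field; rewrite cn0 sn0 rn0.
Qed.

End PairTail.

(** * Monotonicity of the primitive in the angle *)

Section PairTailIntegral.
Context {R : realType}.
Implicit Types x y a b r s t : R.
Local Notation mu := (@lebesgue_measure R).
Local Notation e := (@half_normal_cdf R).
Local Notation p := (@half_normal_pdf R).

Lemma polar_coordinates r a b : 0 < r -> 0 < a -> 0 < b ->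
  r ^+ 2 = a ^+ 2 + b ^+ 2 ->
  [/\ 0 < acos (a / r), acos (a / r) < pi, r * cos (acos (a / r)) = a &
      r * sin (acos (a / r)) = b].
Proof.
move=> r0 a0 b0 r2.
have ar : a < r.
  by rewrite -(@ltr_pXn2r _ 2) ?nnegrE ?ltW// r2 ltrDl exprn_gt0.
have ar0 : 0 < a / r by rewrite divr_gt0.
have ar1 : a / r < 1 by rewrite ltr_pdivrMr// mul1r.
have rn0 : r != 0 by rewrite gt_eqF.
split.
- by rewrite acos_gt0// ar1 andbT; lra.
- by rewrite acos_ltpi// ltW// andbT; lra.
- by rewrite acosK ?in_itv/=; [field|lra].
- rewrite sin_acos; last by lra.
  have -> : 1 - (a / r) ^+ 2 = (b / r) ^+ 2.
    have b2 : b ^+ 2 = r ^+ 2 - a ^+ 2 by rewrite r2; ring.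
    by rewrite !expr_div_n b2; field.
  by rewrite sqrtr_sqr ger0_norm ?divr_ge0 ?ltW//; field.
Qed.

(** Both pairs lie on the circle of radius [r], at angles [th1 <= th2] in [(0, pi / 4]]. Between
    them the angular derivative is nonnegative, by [half_normal_cdf_pdf_ratio] at
    [t / (r * cos th) <= t / (r * sin th)]. *)
Lemma pair_primitive_le a1 b1 a2 b2 r t : 0 <= t -> 0 < r -> 0 < b1 ->
  0 < b2 -> b2 <= a2 -> a2 <= a1 ->
  r ^+ 2 = a1 ^+ 2 + b1 ^+ 2 -> r ^+ 2 = a2 ^+ 2 + b2 ^+ 2 ->
  pair_primitive a1 b1 r t <= pair_primitive a2 b2 r t.
Proof.
move=> t0 r0 b10 b20 b2a2 a2a1 r1 r2.
have a20 : 0 < a2 by exact: lt_le_trans b2a2.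
have a10 : 0 < a1 by exact: lt_le_trans a2a1.
have [+ + + +] := polar_coordinates r a1 b1 r0 a10 b10 r1.
have [+ + + +] := polar_coordinates r a2 b2 r0 a20 b20 r2.
set th2 := acos _; set th1 := acos _.
move=> th20 th2pi a2E b2E th10 th1pi a1E b1E.
have th12 : th1 <= th2.
  rewrite leNgt; apply/negP => th21.
  have : cos th1 < cos th2.
    by rewrite ltr_cos// in_itv/= ?(ltW th10) ?(ltW th20) ltW.
  by rewrite ltNge -(ler_pM2l r0) a1E a2E a2a1.
rewrite -[a1 in leLHS]a1E -[b1 in leLHS]b1E -[a2 in leRHS]a2E -[b2 in leRHS]b2E.
(* The bound [b2 <= a2] says [sin th2 <= cos th2]. At smaller angles the cosine is larger, so the
   inequality persists, by comparing squares that sum to 1. *)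
have sc th : th1 <= th <= th2 -> [/\ 0 < cos th, 0 < sin th & sin th <= cos th].
  move=> /andP[h1 h2].
  have hs : 0 < sin th.
    by rewrite sin_gt0_pi// (lt_le_trans th10)//= (le_lt_trans h2).
  have hc : cos th2 <= cos th.
    rewrite leNgt; apply/negP; rewrite ltr_cos ?in_itv/= ?(ltW th20) ?(ltW th2pi)//.
      by rewrite ltNge h2.
    by rewrite (le_trans (ltW th10))//= (le_trans h2)// ltW.
  have c20 : 0 < cos th2 by rewrite -(pmulr_rgt0 _ r0) a2E.
  have s20 : sin th2 <= cos th2 by rewrite -(ler_pM2l r0) a2E b2E.
  have s20' : 0 < sin th2 by rewrite -(pmulr_rgt0 _ r0) b2E.
  split=> //; first exact: lt_le_trans hc.
  have hc0 : 0 < cos th by exact: lt_le_trans hc.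
  rewrite -(@ler_pXn2r _ 2) ?nnegrE ?(ltW hs) ?(ltW hc0)//.
  have h3 : sin th2 ^+ 2 <= cos th2 ^+ 2.
    by rewrite ler_pXn2r ?nnegrE ?(ltW s20') ?(ltW c20).
  have h4 : cos th2 ^+ 2 <= cos th ^+ 2.
    by rewrite ler_pXn2r ?nnegrE ?(ltW hc0) ?(ltW c20).
  by have := cos2Dsin2 th; have := cos2Dsin2 th2; lra.
pose dV th := r * (sin th * p (t / (r * cos th)) * e (t / (r * sin th))
  - cos th * e (t / (r * cos th)) * p (t / (r * sin th))).
apply: (@is_derive_ge0_le _
  (fun z => pair_primitive (r * cos z) (r * sin z) r t) dV th1 th2 th12).
  by move=> th /sc[c0 s0 _]; exact: is_derive_pair_primitive_theta.
rewrite /dV => th /sc[c0 s0 slec].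
have [->|tn0] := eqVneq t 0.
  by rewrite !mul0r half_normal_cdf0 !mulr0 mul0r subrr mulr0.
have tgt0 : 0 < t by rewrite lt_neqAle eq_sym tn0.
rewrite mulr_ge0 ?(ltW r0)// subr_ge0.
have x0 : 0 < t / (r * cos th) by rewrite divr_gt0 ?mulr_gt0.
have xy : t / (r * cos th) <= t / (r * sin th).
  by rewrite ler_pM2l// lef_pV2 ?posrE ?mulr_gt0// ler_pM2l.
have := half_normal_cdf_pdf_ratio _ _ x0 xy.
set x := t / (r * cos th); set y := t / (r * sin th) => h.
have [rn cn sn] : [/\ r != 0, cos th != 0 & sin th != 0] by rewrite !gt_eqF.
(* This factor turns the coefficient [cos th] into [y] and [sin th] into [x], as in the ratio
   inequality. *)
have k0 : 0 < t / (r * sin th * cos th) by rewrite divr_gt0 ?mulr_gt0.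
rewrite -(ler_pM2l k0).
have -> : t / (r * sin th * cos th) * (cos th * e x * p y) = e x * (y * p y).
  by rewrite {2}/y; field; rewrite rn sn.
have -> : t / (r * sin th * cos th) * (sin th * p x * e y) = e y * (x * p x).
  by rewrite {2}/x; field; rewrite rn cn.
by [].
Qed.

End PairTailIntegral.

(** * Limits at infinity and improper integrals *)

Section PairTailBounds.
Context {R : realType}.
Implicit Types x y a b r s t : R.
Local Notation mu := (@lebesgue_measure R).
Local Notation e := (@half_normal_cdf R).
Local Notation p := (@half_normal_pdf R).

Lemma cvg_divy a : 0 < a -> t / a @[t --> +oo] --> +oo.
Proof. by move=> a0; apply: gt0_cvgMly; [rewrite invr_gt0|exact: cvg_id]. Qed.

Lemma cvg_scaled_ccdf a : 0 < a -> t * (1 - e (t / a)) @[t --> +oo] --> (0 : R).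
Proof.
move=> a0; have an0 : a != 0 by rewrite gt_eqF.
have -> : (fun t => t * (1 - e (t / a))) =
    (fun t => a * ((fun x => x * (1 - e x)) (t / a))).
  by apply/funext => t /=; field.
rewrite -[X in _ --> X](mulr0 a); apply: cvgM; first exact: cvg_cst.
exact: cvg_comp (cvg_divy a a0) cvg_half_normal_ccdf.
Qed.

Lemma cvg_pair_primitive a b r : 0 < a -> 0 < b -> 0 < r ->
  pair_primitive a b r t @[t --> +oo] --> p 0 * r.
Proof.
move=> a0 b0 r0.
have ce c : 0 < c -> e (t / c) @[t --> +oo] --> (1 : R).
  by move=> c0; exact: cvg_comp (cvg_divy c c0) cvg_half_normal_cdf.
have cp c : 0 < c -> p (t / c) @[t --> +oo] --> (0 : R).
  by move=> c0; exact: cvg_comp (cvg_divy c c0) cvg_half_normal_pdf.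
have abr : 0 < a * b / r by rewrite divr_gt0 ?mulr_gt0.
(* Splitting [1 - x * y] as [(1 - x) + x * (1 - y)] leaves [t] multiplied by a single complementary
   distribution function, and such products tend to 0. *)
have -> : pair_primitive a b r = (fun t => t * (1 - e (t / a)) +
    e (t / a) * (t * (1 - e (t / b))) - a * p (t / a) * e (t / b) -
    b * p (t / b) * e (t / a) + p 0 * r * e (t / (a * b / r))).
  apply/funext => t; rewrite /pair_primitive.
  have -> : t / (a * b / r) = t * r / (a * b) by rewrite invf_div mulrA.
  by ring.
rewrite [X in _ --> X](_ : _ =
  0 + 1 * 0 - a * 0 * 1 - b * 0 * 1 + p 0 * r * 1); last by ring.
have cc (c : R) : (fun _ : R => c) t @[t --> +oo] --> c by exact: cvg_cst.
apply: cvgD; last exact: cvgM (cc _) (ce _ abr).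
apply: cvgB; last exact: cvgM (cvgM (cc b) (cp _ b0)) (ce _ a0).
apply: cvgB; last exact: cvgM (cvgM (cc a) (cp _ a0)) (ce _ b0).
apply: cvgD; first exact: cvg_scaled_ccdf.
exact: cvgM (ce _ a0) (cvg_scaled_ccdf _ b0).
Qed.

Lemma half_normal_cdf_continuous : continuous e.
Proof.
by move=> x; apply/differentiable_continuous/derivable1_diffP.
Qed.

Lemma continuous_scaled_cdf a : continuous (fun s => e (s / a)).
Proof.
move=> s; apply: (@continuous_comp _ _ _ (fun s => s / a) e).
  exact: mulrr_continuous.
exact: half_normal_cdf_continuous.
Qed.

Lemma integral_pair_tail a b r t : 0 <= t -> 0 < a -> 0 < b -> 0 < r ->
  r ^+ 2 = a ^+ 2 + b ^+ 2 ->
  (\int[mu]_(s in `[t, +oo[) (1 - e (s / a) * e (s / b))%:E =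
   (p 0 * r - pair_primitive a b r t)%:E)%E.
Proof.
move=> t0 a0 b0 r0 r2.
have dV s : is_derive s 1 (pair_primitive a b r) (1 - e (s / a) * e (s / b)).
  exact: is_derive_pair_primitive_t.
rewrite EFinB; apply: ge0_continuous_FTC2y.
- move=> s ts; have s0 : 0 <= s by exact: le_trans ts.
  rewrite subr_ge0 mulr_ile1 ?half_normal_cdf_le1 ?half_normal_cdf_ge0//.
    by rewrite divr_ge0// ltW.
  by rewrite divr_ge0// ltW.
- apply: continuous_subspaceT => s; apply: cvgB; first exact: cvg_cst.
  by apply: cvgM; exact: continuous_scaled_cdf.
- exact: cvg_pair_primitive.
- by move=> s _; have [] := dV s.
- apply: cvg_at_right_filter; have [+ _] := dV t.
  by move=> /derivable1_diffP/differentiable_continuous.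
- by move=> s _; rewrite derive1E; have [_ ->] := dV s.
Qed.

(** The degenerate pair with one coordinate zero, where [pair_primitive] would divide by 0.
    Integration by parts: [- a * p (s / a)] is a primitive of [s / a * p (s / a)]. *)
Lemma integral_single_tail a t : 0 <= t -> 0 < a ->
  (\int[mu]_(s in `[t, +oo[) (1 - e (s / a))%:E =
   (a * p (t / a) - t * (1 - e (t / a)))%:E)%E.
Proof.
move=> t0 a0; have an0 : a != 0 by rewrite gt_eqF.
pose F := id \* (cst 1 \- (fun s => e (s / a))) \- a \*o (fun s => p (s / a)).
have dV s : is_derive s 1 F (1 - e (s / a)).
  have dl : is_derive s 1 (fun s => s / a) a^-1.
    have -> : (fun s => s / a) = id \* cst a^-1 by [].
    by apply: is_derive_eq; rewrite /GRing.scale/=; ring.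
  have ? : is_derive s 1 (fun s => e (s / a)) (p (s / a) * a^-1).
    exact: (@is_derive1_comp _ e (fun s => s / a)).
  have ? : is_derive s 1 (fun s => p (s / a)) (- (s / a * p (s / a)) * a^-1).
    exact: (@is_derive1_comp _ p (fun s => s / a)).
  by rewrite /F; apply: is_derive_eq; rewrite /GRing.scale/=; field.
have -> : a * p (t / a) - t * (1 - e (t / a)) = 0 - F t by rewrite /F/=; ring.
rewrite EFinB; apply: ge0_continuous_FTC2y.
- by move=> s ts; rewrite subr_ge0 half_normal_cdf_le1.
- apply: continuous_subspaceT => s; apply: cvgB; first exact: cvg_cst.
  exact: continuous_scaled_cdf.
- rewrite -[X in _ --> X](subrr 0) -[X in _ --> _ - X](mulr0 a).
  apply: cvgB; first exact: cvg_scaled_ccdf.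
  apply: cvgM; first exact: cvg_cst.
  exact: cvg_comp (cvg_divy a a0) cvg_half_normal_pdf.
- by move=> s _; have [] := dV s.
- apply: cvg_at_right_filter; have [+ _] := dV t.
  by move=> /derivable1_diffP/differentiable_continuous.
- by move=> s _; rewrite derive1E; have [_ ->] := dV s.
Qed.

End PairTailBounds.

(** * Pairs of arbitrary sign, possibly zero *)

Section ScaledCdf.
Context {R : realType}.
Implicit Types x y a b r s t : R.
Local Notation mu := (@lebesgue_measure R).
Local Notation e := (@half_normal_cdf R).
Local Notation p := (@half_normal_pdf R).

(* The distribution function of [|a * xi_i|] on the half-line [0 <= s]; the
   case [a = 0] is apart because [s / 0 = 0]. *)
Definition scaled_cdf a s : R := if a == 0 then 1 else e (s / `|a|).

(** For [0 <= t], the expected excess over [t] of the maximum of [|a * X|] and [|b * Y|], with [X]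
    and [Y] independent standard normal. *)
Definition pair_tail a b t : \bar R :=
  (\int[mu]_(s in `[t, +oo[) (1 - scaled_cdf a s * scaled_cdf b s)%:E)%E.

Lemma scaled_cdf_norm a : scaled_cdf `|a| = scaled_cdf a.
Proof. by apply/funext => s; rewrite /scaled_cdf normr_eq0 normr_id. Qed.

Lemma scaled_cdf0 s : scaled_cdf 0 s = 1.
Proof. by rewrite /scaled_cdf eqxx. Qed.

Lemma scaled_cdf_gt0 a s : 0 < a -> scaled_cdf a s = e (s / a).
Proof. by move=> a0; rewrite /scaled_cdf gt_eqF// gtr0_norm. Qed.

Lemma scaled_cdf_ge0 a s : 0 <= s -> 0 <= scaled_cdf a s.
Proof.
by move=> s0; rewrite /scaled_cdf; case: ifP => // _;
  rewrite half_normal_cdf_ge0// divr_ge0.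
Qed.

Lemma scaled_cdf_le1 a s : scaled_cdf a s <= 1.
Proof. by rewrite /scaled_cdf; case: ifP => // _; exact: half_normal_cdf_le1. Qed.

Lemma measurable_scaled_cdf a : measurable_fun setT (scaled_cdf a).
Proof.
rewrite /scaled_cdf; case: (a == 0) => //.
by apply: continuous_measurable_fun; exact: continuous_scaled_cdf.
Qed.

Lemma measurable_pair_ccdf a b (D : set R) :
  measurable_fun D (fun s => (1 - scaled_cdf a s * scaled_cdf b s)%:E).
Proof.
apply/measurable_EFinP; apply: measurable_funTS; apply: measurable_funB => //.
by apply: measurable_funM; exact: measurable_scaled_cdf.
Qed.

Lemma pair_ccdf_ge0 a b s : 0 <= s ->
  0 <= 1 - scaled_cdf a s * scaled_cdf b s.
Proof. by move=> s0; rewrite subr_ge0 mulr_ile1 ?scaled_cdf_ge0 ?scaled_cdf_le1. Qed.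

Lemma pair_tailC a b : pair_tail a b = pair_tail b a.
Proof.
by apply/funext => t; apply: eq_integral => s _; congr (1 - _)%:E; exact: mulrC.
Qed.

Lemma pair_tailE a b r t : 0 <= t -> 0 < a -> 0 < b -> 0 < r ->
  r ^+ 2 = a ^+ 2 + b ^+ 2 ->
  pair_tail a b t = (p 0 * r - pair_primitive a b r t)%:E.
Proof.
move=> t0 a0 b0 r0 r2; rewrite -integral_pair_tail//.
by apply: eq_integral => s _; rewrite !scaled_cdf_gt0.
Qed.

Lemma pair_tail_0r a t : 0 <= t -> 0 < a ->
  pair_tail a 0 t = (a * p (t / a) - t * (1 - e (t / a)))%:E.
Proof.
move=> t0 a0; rewrite -integral_single_tail//.
by apply: eq_integral => s _; rewrite scaled_cdf0 mulr1 scaled_cdf_gt0.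
Qed.

(* 1 - xy <= (1 - x) + (1 - y) on [0, 1] *)
Lemma pair_tail_le_0r a b c t : 0 <= t -> 0 < b -> 0 < a -> a <= c ->
  (pair_tail a b t <= pair_tail c 0 t + (p 0 * b)%:E)%E.
Proof.
move=> t0 b0 a0 ac; have c0 : 0 < c by exact: lt_le_trans ac.
have ge0 s : `[t, +oo[%classic s -> 0 <= s.
  by rewrite /= in_itv/= andbT => /(le_trans t0).
apply: (@le_trans _ _ (pair_tail c 0 t + pair_tail b 0 t)%E).
  rewrite /pair_tail -ge0_integralD//=; last 4 first.
  - by move=> s /ge0 s0; rewrite lee_fin pair_ccdf_ge0.
  - exact: measurable_pair_ccdf.
  - by move=> s /ge0 s0; rewrite lee_fin pair_ccdf_ge0.
  - exact: measurable_pair_ccdf.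
  apply: ge0_le_integral => //=.
  - by move=> s /ge0 s0; rewrite lee_fin pair_ccdf_ge0.
  - exact: measurable_pair_ccdf.
  - by apply: emeasurable_funD; exact: measurable_pair_ccdf.
  - move=> s /ge0 s0; rewrite -EFinD lee_fin !scaled_cdf0 !mulr1.
    have h : scaled_cdf c s <= scaled_cdf a s.
      rewrite !scaled_cdf_gt0// half_normal_cdf_le// ler_wpM2l//.
      by rewrite lef_pV2.
    have := scaled_cdf_le1 a s; have := scaled_cdf_le1 b s.
    have := scaled_cdf_ge0 a s s0; have := scaled_cdf_ge0 b s s0.
    by nra.
rewrite leeD2l// pair_tail_0r// lee_fin.
have h1 : p (t / b) <= p 0 by rewrite half_normal_pdf_abs_le// normr0.
have h2 : 0 <= t * (1 - e (t / b)).
  by rewrite mulr_ge0// subr_ge0 half_normal_cdf_le1.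
by rewrite lerBlDr (mulrC b) -[leLHS]addr0 lerD// ler_wpM2r// ltW.
Qed.

(** For positive coordinates this is [pair_primitive_le] read through [pair_tailE]. If [b2 = 0], the
    two pairs are forced to coincide; the case [b1 = 0 < b2] needs a limit. *)
Lemma pair_tail_le_ordered a1 b1 a2 b2 t : 0 <= t -> 0 <= b1 -> 0 <= b2 ->
  b2 <= a2 -> a2 <= a1 -> a1 ^+ 2 + b1 ^+ 2 = a2 ^+ 2 + b2 ^+ 2 ->
  (pair_tail a2 b2 t <= pair_tail a1 b1 t)%E.
Proof.
move=> t0 b10 b20 b2a2 a2a1 sumE.
have pos_case c d : 0 < d -> 0 < b2 -> a2 <= c ->
    c ^+ 2 + d ^+ 2 = a2 ^+ 2 + b2 ^+ 2 ->
    (pair_tail a2 b2 t <= pair_tail c d t)%E.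
  move=> d0 b2p a2c cdE.
  have a2p : 0 < a2 by exact: lt_le_trans b2a2.
  have cp : 0 < c by exact: lt_le_trans a2c.
  pose r := Num.sqrt (a2 ^+ 2 + b2 ^+ 2).
  have r2 : r ^+ 2 = a2 ^+ 2 + b2 ^+ 2 by rewrite sqr_sqrtr ?addr_ge0 ?sqr_ge0.
  have r0 : 0 < r by rewrite sqrtr_gt0 addr_gt0 ?exprn_gt0.
  rewrite (pair_tailE a2 b2 r)// (pair_tailE c d r)//; last by rewrite r2.
  rewrite lee_fin lerD2l lerN2.
  by apply: pair_primitive_le => //; rewrite r2.
have [b2z|b2n] := eqVneq b2 0.
  have a20 : 0 <= a2 by exact: le_trans b2a2.
  have a10 : 0 <= a1 by exact: le_trans a2a1.
  have h : a2 ^+ 2 <= a1 ^+ 2 by rewrite lerXn2r ?nnegrE.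
  have b1z : b1 = 0.
    apply/eqP; rewrite -sqrf_eq0 eq_le sqr_ge0 andbT.
    by move: sumE; rewrite b2z expr0n/=; lra.
  have /eqP -> : a1 == a2.
    by rewrite -(@eqrXn2 _ 2)//; move: sumE; rewrite b1z b2z expr0n/= !addr0 => ->.
  by rewrite b1z b2z lexx.
have b2p : 0 < b2 by rewrite lt_neqAle eq_sym b2n.
have [b1z|b1n] := eqVneq b1 0; last first.
  by apply: pos_case => //; rewrite lt_neqAle eq_sym b1n.
have a2p : 0 < a2 by exact: lt_le_trans b2a2.
have a1p : 0 < a1 by exact: lt_le_trans a2a1.
have p0 : 0 < p 0 by exact: half_normal_pdf_gt0.
(* [b1 = 0] is approached by pairs [(c, d)] with [d] small and positive. *)
rewrite b1z; apply/lee_addgt0Pr => eps eps0.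
(* The bound [d <= b2] keeps [c] at least [a2], and [d <= eps / p 0] keeps the error [p 0 * d]
   within [eps]. *)
pose d := Num.min b2 (eps / p 0).
have d0 : 0 < d by rewrite lt_min b2p divr_gt0.
have db2 : d ^+ 2 <= b2 ^+ 2.
  by rewrite lerXn2r ?nnegrE ?(ltW d0)// ge_min lexx.
have a1E : a1 ^+ 2 = a2 ^+ 2 + b2 ^+ 2 by rewrite -sumE b1z expr0n/= addr0.
pose c := Num.sqrt (a1 ^+ 2 - d ^+ 2).
have c2 : c ^+ 2 = a1 ^+ 2 - d ^+ 2.
  by rewrite sqr_sqrtr//; have := sqr_ge0 a2; lra.
have a2c : a2 <= c.
  by rewrite -(@ler_pXn2r _ 2) ?nnegrE ?sqrtr_ge0 ?(ltW a2p)// c2; lra.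
have c0 : 0 < c by exact: lt_le_trans a2c.
have ca1 : c <= a1.
  rewrite -(@ler_pXn2r _ 2) ?nnegrE ?(ltW c0) ?(ltW a1p)// c2.
  by have := sqr_ge0 d; lra.
apply: (@le_trans _ _ (pair_tail c d t)).
  by apply: pos_case => //; rewrite c2 a1E; ring.
apply: (le_trans (pair_tail_le_0r c d a1 t t0 d0 c0 ca1)).
rewrite leeD2l// lee_fin mulrC -ler_pdivlMr//.
by rewrite ge_min lexx orbT.
Qed.

Lemma pair_tail_norm a b : pair_tail `|a| `|b| = pair_tail a b.
Proof. by rewrite /pair_tail !scaled_cdf_norm. Qed.

(** Only absolute values matter, and symmetry of [pair_tail] allows [a2] and [b2] to be put in
    decreasing order. *)
Lemma pair_tail_le a1 b1 a2 b2 t : 0 <= t ->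
  a2 ^+ 2 <= a1 ^+ 2 -> b2 ^+ 2 <= a1 ^+ 2 ->
  a1 ^+ 2 + b1 ^+ 2 = a2 ^+ 2 + b2 ^+ 2 ->
  (pair_tail a2 b2 t <= pair_tail a1 b1 t)%E.
Proof.
move=> t0; rewrite -(pair_tail_norm a2) -(pair_tail_norm a1).
rewrite -(real_normK (num_real a1)) -(real_normK (num_real b1)).
rewrite -(real_normK (num_real a2)) -(real_normK (num_real b2)).
have := normr_ge0 a1; have := normr_ge0 b1.
have := normr_ge0 a2; have := normr_ge0 b2.
move: `|a1| `|b1| `|a2| `|b2| => {}a1 {}b1 {}a2 {}b2 b20 a20 b10 a10.
move=> a21 b21 sumE.
have {}a21 : a2 <= a1 by rewrite -(@ler_pXn2r _ 2) ?nnegrE.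
have {}b21 : b2 <= a1 by rewrite -(@ler_pXn2r _ 2) ?nnegrE.
have [ba|ab] := leP b2 a2; first exact: pair_tail_le_ordered.
rewrite pair_tailC; apply: pair_tail_le_ordered => //; first exact: ltW.
by rewrite sumE addrC.
Qed.

(** At [t = 0] every term of [pair_primitive] carries a factor [t] or [e 0], so only the radius
    survives. Hence the expected maximum is constant on unit vectors with at most two non-zero
    coordinates. *)
Lemma pair_tail_at0 a b r : 0 < r -> r ^+ 2 = a ^+ 2 + b ^+ 2 ->
  pair_tail a b 0 = (p 0 * r)%:E.
Proof.
move=> r0; rewrite -pair_tail_norm -(real_normK (num_real a)) -(real_normK (num_real b)).
have := normr_ge0 a; have := normr_ge0 b.
move: `|a| `|b| => {}a {}b b0 a0 r2.
have single c : 0 <= c -> r ^+ 2 = c ^+ 2 -> pair_tail c 0 0 = (p 0 * r)%:E.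
  move=> c0 /eqP; rewrite eqrXn2 ?(ltW r0)// => /eqP <-.
  by rewrite pair_tail_0r// !mul0r subr0 mulrC.
have [a0z|an] := eqVneq a 0.
  by rewrite a0z pair_tailC single// r2 a0z expr0n/= add0r.
have [b0z|bn] := eqVneq b 0.
  by rewrite b0z single// r2 b0z expr0n/= addr0.
have a1 : 0 < a by rewrite lt_neqAle eq_sym an.
have b1 : 0 < b by rewrite lt_neqAle eq_sym bn.
rewrite (pair_tailE a b r)//; congr EFin.
by rewrite /pair_primitive !mul0r half_normal_cdf0; ring.
Qed.

End ScaledCdf.

(** * Integration over the other coordinates *)

Section LayerCake.
Context {d : measure_display} {T : measurableType d} {R : realType}.
Variable P : probability T R.
Local Notation mu := (@lebesgue_measure R).

Lemma measurable_sublevel (M : T -> R) (s : R) :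
  measurable_fun setT M -> measurable [set x | M x <= s].
Proof.
move=> mM; have := mM measurableT `]-oo, s]%classic (measurable_itv _).
by rewrite setTI; congr measurable.
Qed.

(** Tonelli on the region [M x <= s]. As [M] is nonnegative, the region lies over [0 <= s], where
    [f] is nonnegative. *)
Lemma integral_mul_cdf (f : R -> R) (M : T -> R) :
  measurable_fun setT f -> (forall s, 0 <= s -> 0 <= f s) ->
  measurable_fun setT M -> (forall x, 0 <= M x) ->
  measurable_fun setT (fun x => \int[mu]_(s in `[M x, +oo[) (f s)%:E)%E /\
  (\int[mu]_(s in `[0%R, +oo[) ((f s)%:E * P [set x | M x <= s]%R) =
   \int[P]_x \int[mu]_(s in `[M x, +oo[) (f s)%:E)%E.
Proof.
move=> mf f0 mM M0.
pose L (z : T * measurableTypeR R) := M z.1 <= z.2.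
have mL : measurable [set z | L z].
  have : measurable_fun setT L.
    by apply: measurable_fun_ler; [exact: measurableT_comp|exact: measurable_snd].
  by move=> /(_ measurableT [set true]); rewrite setTI; exact.
pose F (z : T * measurableTypeR R) : \bar R := (f z.2 * \1_[set z | L z] z)%:E.
have FE x s : F (x, s) = if M x <= s then (f s)%:E else 0%E.
  rewrite /F indicE /= (_ : ((x, s) \in _) = (M x <= s)); last first.
    by apply/idP/idP; rewrite inE.
  by case: ifP => _; rewrite ?mulr1 ?mulr0.
have F0 z : (0 <= F z)%E.
  case: z => x s; rewrite FE; case: ifP => // h.
  by rewrite lee_fin f0// (le_trans (M0 x)).
have mF : measurable_fun setT F.
  apply/measurable_EFinP; apply: measurable_funM.
    by apply: measurableT_comp; [exact: mf|exact: measurable_snd].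
  exact: measurable_indic.
have inner x : (\int[mu]_(s in `[M x, +oo[) (f s)%:E = \int[mu]_s F (x, s))%E.
  rewrite [LHS]integral_mkcond; apply: eq_integral => s _; rewrite patchE FE.
  rewrite (_ : (s \in _) = (M x <= s))//.
  by apply/idP/idP; rewrite inE/= in_itv/= andbT.
split.
  rewrite (_ : (fun x => _) = fubini_F mu F); last by apply/funext.
  exact: measurable_fun_fubini_tonelli_F.
under [RHS]eq_integral do rewrite inner.
rewrite (fubini_tonelli (m1 := P) (m2 := mu) F mF F0).
rewrite [LHS]integral_mkcond; apply: eq_integral => s _; rewrite patchE.
case: ifPn => [|]; rewrite ?inE ?notin_setE/= in_itv/= andbT => s0.
  have mMs := measurable_sublevel M s mM.
  transitivity (\int[P]_x ((f s)%:E * (\1_[set x | M x <= s] x)%:E))%E.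
    rewrite ge0_integralZl//=.
    - by rewrite integral_indic// setIT.
    - by apply/measurable_EFinP; exact: measurable_indic.
    - by rewrite lee_fin f0.
  apply: eq_integral => x _; rewrite FE indicE /= (_ : (x \in _) = (M x <= s)).
    by case: ifP => _; rewrite ?mule1 ?mule0.
  by apply/idP/idP; rewrite inE.
(* For negative [s] no [x] satisfies [M x <= s]. *)
apply/esym; apply: integral0_eq => x _; rewrite FE; case: ifP => // Ms.
by move: s0; rewrite (le_trans (M0 x) Ms).
Qed.

(** Weighting with the distribution function of [M] averages the tail integrals started at [M x]. So
    it suffices to compare tail integrals, while [f] and [g] themselves may cross. *)
Lemma le_integral_mul_cdf (f g : R -> R) (M : T -> R) :
  measurable_fun setT f -> (forall s, 0 <= s -> 0 <= f s) ->
  measurable_fun setT g -> (forall s, 0 <= s -> 0 <= g s) ->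
  measurable_fun setT M -> (forall x, 0 <= M x) ->
  (forall t : R, 0 <= t ->
    (\int[mu]_(s in `[t, +oo[) (f s)%:E <=
     \int[mu]_(s in `[t, +oo[) (g s)%:E)%E) ->
  (\int[mu]_(s in `[0%R, +oo[) ((f s)%:E * P [set x | M x <= s]%R) <=
   \int[mu]_(s in `[0%R, +oo[) ((g s)%:E * P [set x | M x <= s]%R))%E.
Proof.
move=> mf f0 mg g0 mM M0 fg.
have [mfM ->] := integral_mul_cdf f M mf f0 mM M0.
have [mgM ->] := integral_mul_cdf g M mg g0 mM M0.
apply: ge0_le_integral => //.
- move=> x _; apply: integral_ge0 => s /=.
  by rewrite in_itv/= andbT lee_fin => /(le_trans (M0 x)) /f0.
- by move=> x _; exact: fg.
Qed.

End LayerCake.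

(** * The distribution of the maximum *)

Section SupNormLaw.
Context {d : measure_display} {T : measurableType d} {R : realType}.
Variables (P : probability T R) (n : nat) (xi : 'I_n -> {RV P >-> R}).
Hypothesis hxi : standard_normal_vector xi.
Implicit Types (w : 'I_n -> R) (J : {set 'I_n}) (s : R).
Local Notation mu := (@lebesgue_measure R).

Definition partial_sup J w (x : T) : R :=
  \big[Num.max/0]_(i in J) `|w i * xi i x|.

Lemma partial_sup_ge0 J w x : 0 <= partial_sup J w x.
Proof. exact: bigmax_ge_id. Qed.

Lemma measurable_partial_sup J w : measurable_fun setT (partial_sup J w).
Proof.
rewrite /partial_sup unlock /reducebig /=.
elim: (index_enum _) => [|i r IH] /=; first exact: measurable_cst.
case: (i \in J) => //=; apply: measurable_maxr => //.
apply: measurableT_comp => //; apply: measurable_funM => //.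
Qed.

Lemma scaled_normal_prob i (a s : R) : 0 <= s ->
  P (xi i @^-1` [set x | `|a * x| <= s]) = (scaled_cdf a s)%:E.
Proof.
move=> s0; rewrite /scaled_cdf; have [->|a0] := eqVneq a 0.
  rewrite (_ : [set x | _] = setT) ?preimage_setT ?probability_setT//.
  by apply/seteqP; split => // x _ /=; rewrite mul0r normr0.
have na : 0 < `|a| by rewrite normr_gt0.
rewrite (_ : [set x | _] = `[- (s / `|a|), s / `|a|]%classic).
  have [_ /(_ i) h] := hxi.
  rewrite -half_normal_cdf_prob ?divr_ge0//.
  by have := h _ (measurable_itv `[- (s / `|a|), s / `|a|]).
apply/seteqP; split => x /=; rewrite in_itv/= -ler_norml ler_pdivlMr//.
  by rewrite normrM mulrC.
by rewrite normrM mulrC.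
Qed.

(** The maximum is at most [s] exactly when each term is, its default 0 being harmless as [0 <= s];
    independence turns the intersection over [J] into a product. *)
Lemma cdf_partial_sup J w s : 0 <= s ->
  P [set x | partial_sup J w x <= s] = (\prod_(i in J) scaled_cdf (w i) s)%:E.
Proof.
move=> s0; have [ind _] := hxi.
pose B i := [set x : R | `|w i * x| <= s].
have mB i : measurable (B i).
  apply: (@measurable_sublevel _ _ _ (fun x : R => `|w i * x|)).
  by apply: measurableT_comp => //; apply: measurable_funM.
rewrite (_ : [set x | _] = \bigcap_(i in [set` J]) (xi i @^-1` B i)).
  rewrite ind; last by move=> i _; exact: mB.
  rewrite (big_morph EFin (id1 := 1%E) (op1 := *%E))//.
  by apply: eq_bigr => i _; rewrite scaled_normal_prob.
apply/seteqP; split => x /=.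
  move=> /bigmax_leP[_ h] i iJ; exact: h.
by move=> h; apply/bigmax_leP; split=> // i iJ; exact: (h i iJ).
Qed.

Lemma expected_sup_normE (u : 'rV[R]_n) :
  expected_sup_norm xi u =
  (\int[mu]_(s in `[0%R, +oo[) (1 - \prod_(i < n) scaled_cdf (u 0%R i) s)%:E)%E.
Proof.
pose M := partial_sup [set: 'I_n]%SET (u 0).
have mM : M \in mfun by rewrite inE; exact: measurable_partial_sup.
have -> : expected_sup_norm xi u = ('E_P[mfun_Sub mM])%E.
  rewrite /expected_sup_norm; congr ('E_P[_])%E; apply/funext => x.
  rewrite sup_norm_odot; apply: eq_bigl => i.
  by rewrite inE.
rewrite ge0_expectation_ccdf; last by move=> x; exact: partial_sup_ge0.
apply: eq_integral => s; rewrite inE/= in_itv/= andbT => s0.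
rewrite ccdf_1_cdf /cdf /distribution /pushforward/=.
rewrite (_ : M @^-1` _ = [set x | M x <= s]); last first.
  by apply/seteqP; split => x /=; rewrite in_itv.
rewrite cdf_partial_sup// EFinB; congr (1 - _%:E)%E.
by apply: eq_bigl => i; rewrite inE.
Qed.

End SupNormLaw.

(** * Changing two coordinates *)

Section PairReplacement.
Context {d : measure_display} {T : measurableType d} {R : realType}.
Variables (P : probability T R) (n : nat) (xi : 'I_n -> {RV P >-> R}).
Hypothesis hxi : standard_normal_vector xi.
Local Notation mu := (@lebesgue_measure R).

Lemma measurable_prod_scaled_cdf (J : {set 'I_n}) (w : 'I_n -> R) :
  measurable_fun setT (fun s => \prod_(i in J) scaled_cdf (w i) s).
Proof.
under eq_fun do rewrite -big_filter.
by apply: measurable_prod => i _; exact: measurable_scaled_cdf.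
Qed.

(** With [K] the product over the other coordinates, [1 - x * y * K = (1 - x * y) * K + (1 - K)].
    The last summand does not involve [i] and [j], and [K] is the distribution function of the
    maximum of the others, so the first has the form treated in [integral_mul_cdf]. *)
Lemma expected_sup_norm_pairE (u : 'rV[R]_n) (i j : 'I_n) : i != j ->
  let J := (~: [set i; j])%SET in
  expected_sup_norm xi u =
  (\int[mu]_(s in `[0%R, +oo[)
     ((1 - scaled_cdf (u ord0 i) s * scaled_cdf (u ord0 j) s)%:E *
      P [set x | partial_sup P n xi J (u ord0) x <= s]%R) +
   \int[mu]_(s in `[0%R, +oo[)
     (1 - \prod_(k in J) scaled_cdf (u ord0 k) s)%:E)%E.
Proof.
move=> ij J; rewrite (expected_sup_normE _ _ _ hxi).
have ge0 s : `[0, +oo[%classic s -> 0 <= s by rewrite /= in_itv/= andbT.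
have K01 s : 0 <= s -> 0 <= \prod_(k in J) scaled_cdf (u ord0 k) s <= 1.
  move=> s0; rewrite prodr_ge0; last by move=> k _; exact: scaled_cdf_ge0.
  by apply: prodr_ile1 => k _; rewrite scaled_cdf_ge0// scaled_cdf_le1.
transitivity (\int[mu]_(s in `[0%R, +oo[)
    (((1 - scaled_cdf (u ord0 i) s * scaled_cdf (u ord0 j) s) *
      \prod_(k in J) scaled_cdf (u ord0 k) s)%:E +
     (1 - \prod_(k in J) scaled_cdf (u ord0 k) s)%:E))%E.
  apply: eq_integral => s _; rewrite -EFinD; congr EFin.
  rewrite (bigD1 i)//= (bigD1 j) 1?eq_sym//=.
  rewrite (eq_bigl (fun k => k \in J)); last first.
    by move=> k; rewrite !inE negb_or.
  by ring.
rewrite ge0_integralD//=.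
- congr (_ + _)%E; apply: eq_integral => s; rewrite inE => /ge0 s0.
  by rewrite cdf_partial_sup// EFinM.
- move=> s /ge0 s0; have /andP[K0 _] := K01 s s0.
  by rewrite lee_fin mulr_ge0// pair_ccdf_ge0.
- apply/measurable_EFinP; apply: measurable_funTS; apply: measurable_funM.
    apply: measurable_funB => //.
    by apply: measurable_funM; exact: measurable_scaled_cdf.
  exact: measurable_prod_scaled_cdf.
- by move=> s /ge0 s0; rewrite lee_fin subr_ge0; have /andP[] := K01 s s0.
- apply/measurable_EFinP; apply: measurable_funTS; apply: measurable_funB => //.
  exact: measurable_prod_scaled_cdf.
Qed.

Lemma expected_sup_norm_pair_le (u v : 'rV[R]_n) (i j : 'I_n) : i != j ->
  (forall k, k != i -> k != j -> u ord0 k = v ord0 k) ->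
  (forall t, 0 <= t -> (pair_tail (u ord0 i) (u ord0 j) t <=
                        pair_tail (v ord0 i) (v ord0 j) t)%E) ->
  (expected_sup_norm xi u <= expected_sup_norm xi v)%E.
Proof.
move=> ij uv tail.
rewrite (expected_sup_norm_pairE u i j ij) (expected_sup_norm_pairE v i j ij).
set J := (~: _)%SET.
have uvJ k : k \in J -> u ord0 k = v ord0 k.
  by rewrite !inE negb_or => /andP[]; exact: uv.
have -> : partial_sup P n xi J (u ord0) = partial_sup P n xi J (v ord0).
  by apply/funext => x; apply: eq_bigr => k kJ; rewrite uvJ.
have -> : (fun s => (1 - \prod_(k in J) scaled_cdf (u ord0 k) s)%:E) =
          (fun s => (1 - \prod_(k in J) scaled_cdf (v ord0 k) s)%:E).
  apply/funext => s; congr (1 - _)%:E.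
  by apply: eq_bigr => k kJ; rewrite uvJ.
apply: leeD2r; apply: le_integral_mul_cdf tail.
- by apply/measurable_EFinP; exact: measurable_pair_ccdf.
- by move=> s s0; exact: pair_ccdf_ge0.
- by apply/measurable_EFinP; exact: measurable_pair_ccdf.
- by move=> s s0; exact: pair_ccdf_ge0.
- exact: measurable_partial_sup.
- by move=> x; exact: partial_sup_ge0.
Qed.

Lemma expected_sup_norm_sqr (u v : 'rV[R]_n) :
  (forall k, u ord0 k ^+ 2 = v ord0 k ^+ 2) ->
  expected_sup_norm xi u = expected_sup_norm xi v.
Proof.
move=> uv; rewrite !(expected_sup_normE _ _ _ hxi); apply: eq_integral => s _.
congr (1 - _)%:E; apply: eq_bigr => k _.
rewrite -(scaled_cdf_norm (u ord0 k)) -(scaled_cdf_norm (v ord0 k)).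
by rewrite -!sqrtr_sqr uv.
Qed.

(** Zero coordinates contribute factors 1, so this is [pair_tail] at [t = 0] with radius 1. *)
Lemma expected_sup_norm_two (u : 'rV[R]_n) (i j : 'I_n) : i != j ->
  unit_vectors u -> (forall k, k != i -> k != j -> u ord0 k = 0) ->
  expected_sup_norm xi u = (half_normal_pdf (0 : R))%:E.
Proof.
move=> ij uu u0; rewrite (expected_sup_normE _ _ _ hxi).
rewrite -[X in X%:E]mulr1 -(pair_tail_at0 (u ord0 i) (u ord0 j) 1 ltr01).
- apply: eq_integral => s _; congr (1 - _)%:E.
  rewrite (bigD1 i)//= (bigD1 j) 1?eq_sym//= big1 ?mulr1// => k /andP[ki kj].
  by rewrite u0// scaled_cdf0.
- rewrite expr1n -[LHS]uu (bigD1 i)//= (bigD1 j) 1?eq_sym//= big1 ?addr0//.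
  by move=> k /andP[ki kj]; rewrite u0// expr0n.
Qed.

Definition set2 (u : 'rV[R]_n) (i j : 'I_n) (a b : R) : 'rV[R]_n :=
  \row_k (if k == i then a else if k == j then b else u ord0 k).

Lemma set2E1 (u : 'rV[R]_n) (i j : 'I_n) (a b : R) : set2 u i j a b ord0 i = a.
Proof. by rewrite mxE eqxx. Qed.

Lemma set2E2 (u : 'rV[R]_n) (i j : 'I_n) (a b : R) : i != j -> set2 u i j a b ord0 j = b.
Proof. by move=> ij; rewrite mxE eq_sym (negbTE ij) eqxx. Qed.

Lemma set2E (u : 'rV[R]_n) (i j : 'I_n) (a b : R) k :
  k != i -> k != j -> set2 u i j a b ord0 k = u ord0 k.
Proof. by move=> ki kj; rewrite mxE (negbTE ki) (negbTE kj). Qed.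

Lemma unit_vectors_set2 (u : 'rV[R]_n) (i j : 'I_n) (a b : R) : i != j ->
  a ^+ 2 + b ^+ 2 = u ord0 i ^+ 2 + u ord0 j ^+ 2 ->
  unit_vectors u -> unit_vectors (set2 u i j a b).
Proof.
move=> ij ab; rewrite /unit_vectors/= => <-.
rewrite (bigD1 i)//= [RHS](bigD1 i)//= (bigD1 j) 1?eq_sym//=.
rewrite [in RHS](bigD1 j) 1?eq_sym//= !addrA set2E1 set2E2// ab; congr (_ + _).
by apply: eq_bigr => k /andP[ki kj]; rewrite set2E.
Qed.

(** A support with fewer than two elements is padded with arbitrary indices, which [2 <= n]
    provides. *)
Lemma support_two (u : 'rV[R]_n) : (2 <= n)%N ->
  (#|[set i : 'I_n | (u ord0 i != 0)%R]%SET| <= 2)%N ->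
  exists i j, i != j /\ forall k, k != i -> k != j -> u ord0 k = 0.
Proof.
move=> n2; set S := [set i | _]%SET => S2.
have SP k : k \notin S -> u ord0 k = 0 by rewrite inE negbK => /eqP.
have other i : exists j : 'I_n, i != j.
  have [->|] := eqVneq i (Ordinal (ltnW n2)); last by exists (Ordinal (ltnW n2)).
  by exists (Ordinal n2).
have [S0|[i iS]] := set_0Vmem S.
  have [j ij] := other (Ordinal (ltnW n2)).
  by exists (Ordinal (ltnW n2)), j; split=> // k _ _; apply: SP; rewrite S0 inE.
have [S0|[j jS]] := set_0Vmem (S :\ i)%SET.
  have [j ij] := other i; exists i, j; split=> // k ki _; apply: SP.
  by have := finset.in_set0 k; rewrite -S0 in_setD1 ki /= => ->.
exists i, j; move: (jS); rewrite in_setD1 => /andP[ji _].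
split=> [|k ki kj]; first by rewrite eq_sym.
apply: SP; apply/negP => kS; move: S2; rewrite (cardsD1 i) iS (cardsD1 j) jS.
by rewrite (cardsD1 k) !in_setD1 ki kj kS.
Qed.

Lemma expected_sup_norm_support_two (u : 'rV[R]_n) : (2 <= n)%N ->
  unit_vectors u -> (#|[set i : 'I_n | (u ord0 i != 0)%R]%SET| <= 2)%N ->
  expected_sup_norm xi u = (half_normal_pdf (0 : R))%:E.
Proof.
move=> n2 uu /(support_two _ n2)[i [j [ij u0]]].
exact: expected_sup_norm_two ij uu u0.
Qed.

(** Induction on the number of non-zero coordinates. While there are more than two, a pair of them
    is replaced by its radius and 0, the most unequal split of the same sum of squares. *)
Lemma expected_sup_norm_le (u : 'rV[R]_n) : (2 <= n)%N -> unit_vectors u ->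
  (expected_sup_norm xi u <= (half_normal_pdf (0 : R))%:E)%E.
Proof.
move=> n2; have [m] := ubnP #|[set i : 'I_n | (u ord0 i != 0)%R]%SET|.
elim: m u => // m IH u um uu.
have [u2|u2] := leqP #|[set i : 'I_n | (u ord0 i != 0)%R]%SET| 2.
  by rewrite expected_sup_norm_support_two ?lexx.
have /card_gt1P[i [j [iS jS ij]]] := ltnW u2.
pose a := Num.sqrt (u ord0 i ^+ 2 + u ord0 j ^+ 2).
have a2 : a ^+ 2 = u ord0 i ^+ 2 + u ord0 j ^+ 2.
  by rewrite sqr_sqrtr// addr_ge0 ?sqr_ge0.
pose v := set2 u i j a 0.
have a02 : a ^+ 2 + 0 ^+ 2 = u ord0 i ^+ 2 + u ord0 j ^+ 2.
  by rewrite a2 expr0n addr0.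
apply: (@le_trans _ _ (expected_sup_norm xi v)).
  apply: (expected_sup_norm_pair_le u v i j ij).
    by move=> k ki kj; rewrite set2E.
  move=> t t0; rewrite set2E1 (set2E2 _ _ _ _ _ ij).
  apply: (pair_tail_le _ _ _ _ _ t0).
  - by rewrite a2 lerDl sqr_ge0.
  - by rewrite a2 lerDr sqr_ge0.
  - exact: a02.
apply: IH; last exact: unit_vectors_set2.
(* The support strictly shrinks: [j] leaves it, and [i] belonged to it already. *)
rewrite -ltnS; apply: leq_trans um; rewrite ltnS.
apply: proper_card; apply/properP; split; last first.
  by exists j; rewrite // inE set2E2// eqxx.
apply/fintype.subsetP => k; rewrite !inE mxE.
have [->|_] := eqVneq k i; first by move: iS; rewrite inE.
by have [->|_] := eqVneq k j; first by rewrite eqxx.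
Qed.

(** Nonnegative terms with sum 0 all vanish, so a non-zero deviation entails a negative one; applied
    to [f i - c] and to [c - f i], this gives both indices. *)
Lemma exists_below_above (I : finType) (f : I -> R) (c : R) (i0 : I) :
  \sum_i (f i - c) = 0 -> f i0 != c -> exists i j, f i < c /\ c < f j.
Proof.
move=> sum0 fi0.
have lt0 (g : I -> R) : \sum_i g i = 0 -> g i0 != 0 -> exists i, g i < 0.
  move=> g0 gi0; have [/existsP[i gi]|/existsPn h] := boolP [exists i, g i < 0].
    by exists i.
  move: gi0; rewrite (psumr_eq0P _ g0) ?eqxx//.
  by move=> i _; rewrite leNgt h.
have [|i fi] := lt0 _ sum0; first by rewrite subr_eq0.
have [||j fj] := lt0 (fun i => c - f i).
- transitivity (- \sum_i (f i - c)); last by rewrite sum0 oppr0.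
  by rewrite -sumrN; apply: eq_bigr => k _; rewrite opprB.
- by rewrite subr_eq0 eq_sym.
by exists i, j; rewrite -subr_lt0 fi -subr_lt0.
Qed.

(** Induction on the number of coordinates whose square differs from [1 / n]. The squares average to
    [1 / n], so if one differs, some lie below and some above. *)
Lemma expected_sup_norm_ge (w u : 'rV[R]_n) :
  (forall i, w ord0 i ^+ 2 = n%:R^-1) -> unit_vectors u ->
  (expected_sup_norm xi w <= expected_sup_norm xi u)%E.
Proof.
move=> wE; set q : R := n%:R^-1.
have [m] := ubnP #|[set i : 'I_n | (u ord0 i ^+ 2 != q)%R]%SET|.
elim: m u => // m IH u um uu.
have [S0|[i0]] := set_0Vmem [set i : 'I_n | (u ord0 i ^+ 2 != q)%R]%SET.
  rewrite (expected_sup_norm_sqr w u) ?lexx// => k; rewrite wE.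
  by have := finset.in_set0 k; rewrite -S0 inE => /negbFE /eqP ->.
rewrite inE => ui0.
have n0 : n%:R != 0 :> R.
  by rewrite pnatr_eq0 -lt0n; apply: leq_ltn_trans (ltn_ord i0).
have sum0 : \sum_i (u ord0 i ^+ 2 - q) = 0.
  rewrite sumrB uu sumr_const card_ord -[q *+ n]mulr_natr mulVf// subrr//.
have [i [j [iq qj]]] := exists_below_above _ _ _ _ sum0 ui0.
have ij : i != j by apply/eqP => E; move: iq; rewrite E ltNge (ltW qj).
have q0 : 0 <= q by rewrite invr_ge0 ler0n.
(* Coordinate [i] gets the square [q] exactly and [j] absorbs the rest, which is nonnegative because
   the square at [j] exceeds [q]. *)
pose a := Num.sqrt q; pose b := Num.sqrt (u ord0 i ^+ 2 + u ord0 j ^+ 2 - q).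
have a2 : a ^+ 2 = q by rewrite sqr_sqrtr.
have b2 : b ^+ 2 = u ord0 i ^+ 2 + u ord0 j ^+ 2 - q.
  by rewrite sqr_sqrtr//; have := sqr_ge0 (u ord0 i); lra.
pose v := set2 u i j a b.
have ab2 : a ^+ 2 + b ^+ 2 = u ord0 i ^+ 2 + u ord0 j ^+ 2.
  by rewrite a2 b2; ring.
apply: (@le_trans _ _ (expected_sup_norm xi v)); last first.
  apply: (expected_sup_norm_pair_le v u i j ij).
    by move=> k ki kj; rewrite set2E.
  (* The pair of [u] is swapped so that the entry with the larger square, at [j], comes first. *)
  move=> t t0; rewrite set2E1 (set2E2 _ _ _ _ _ ij) (pair_tailC (u ord0 i)).
  apply: (pair_tail_le _ _ _ _ _ t0).
  - by rewrite a2 ltW.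
  - by rewrite b2; lra.
  - by rewrite ab2 addrC.
apply: IH; last exact: unit_vectors_set2.
rewrite -ltnS; apply: leq_trans um; rewrite ltnS.
apply: proper_card; apply/properP; split; last first.
  by exists i; rewrite inE ?set2E1 ?a2 ?eqxx// lt_eqF.
apply/fintype.subsetP => k; rewrite !inE mxE.
have [->|_] := eqVneq k i; first by rewrite a2 eqxx.
have [->|_] := eqVneq k j; first by move=> _; rewrite gt_eqF.
by [].
Qed.

End PairReplacement.

Theorem theorem1 (d : measure_display) (T : measurableType d) (R : realType)
    (P : probability T R) (n : nat) (xi : 'I_n -> {RV P >-> R})
    (hxi : standard_normal_vector xi) :
  (n = 2%N ->
     forall u v : 'rV[R]_n, unit_vectors u -> unit_vectors v ->
       expected_sup_norm xi u = expected_sup_norm xi v) /\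
  ((3 <= n)%N ->
     (forall u : 'rV[R]_n, unit_vectors u ->
        (#|[set i : 'I_n | (u 0 i != 0)%R]%SET| <= 2)%N ->
        attains_max_at (expected_sup_norm xi) unit_vectors u) /\
     (forall u : 'rV[R]_n,
        (forall i : 'I_n, u 0 i = 1 / Num.sqrt n%:R \/
                          u 0 i = - (1 / Num.sqrt n%:R)) ->
        attains_min_at (expected_sup_norm xi) unit_vectors u)).
Proof.
split=> [n2 u v uu uv|n3].
  have n2' : (2 <= n)%N by rewrite n2.
  have supp (w : 'rV[R]_n) : (#|[set i : 'I_n | (w ord0 i != 0)%R]%SET| <= 2)%N.
    by apply: leq_trans (max_card _) _; rewrite card_ord n2.
  rewrite (expected_sup_norm_support_two _ _ _ hxi u n2' uu (supp u)).
  by rewrite (expected_sup_norm_support_two _ _ _ hxi v n2' uv (supp v)).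
have n2 : (2 <= n)%N by exact: ltnW.
split=> [u uu u2|u uE].
  (* The common value [half_normal_pdf 0] on supports of size at most two is also the upper
     bound. *)
  split=> // v uv.
  rewrite (expected_sup_norm_support_two _ _ _ hxi u n2 uu u2).
  exact: (expected_sup_norm_le _ _ _ hxi v n2 uv).
have u2 i : u 0 i ^+ 2 = n%:R^-1.
  by case: (uE i) => ->; rewrite ?sqrrN expr_div_n expr1n sqr_sqrtr ?ler0n// div1r.
split=> [|v uv].
  rewrite /unit_vectors/= (eq_bigr (fun=> n%:R^-1)); last by move=> i _; exact: u2.
  rewrite sumr_const card_ord -[LHS]mulr_natr mulVf// pnatr_eq0 -lt0n.
  exact: ltn_trans n2.
exact: (expected_sup_norm_ge _ _ _ hxi u v u2 uv).
Qed.
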